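(* For every $n\geq 2$, the graph $L_n$ admits a drawing in which the set of vertices is strictly convex and the set of midpoints of edges is weakly convex, i.e., $L_n\in\mathcal{G}_s^w$. Consequently $g_s^w(n)\geq 2n-3$.
   Context: For $n\geq 2$, $L_n$ is the graph consisting of two paths $P=(u_1,\ldots,u_{\lfloor n/2\rfloor})$ and $Q=(v_1,\ldots,v_{\lceil n/2\rceil})$ together with the edges $u_1v_1$, $u_iv_{i-1}$ for $1<i\leq\lfloor n/2\rfloor$, and $u_{j-1}v_j$ for $1<j\leq\lceil n/2\rceil$; it has $n$ vertices and $2n-3$ edges. A finite point set $X\subseteq\mathbb{R}^2$ is strictly convex if every point of $X$ is a vertex of its convex hull, and weakly convex if $X$ lies on the boundary of its convex hull. A drawing of a graph is a map of its vertices to $\mathbb{R}^2$, edges drawn as straight segments, such that no two vertices coincide, no two edge midpoints coincide, and no edge midpoint coincides with a vertex. $\mathcal{G}_s^w$ is the class of graphs with a drawing whose vertex set is strictly convex and whose edge-midpoint set is weakly convex; $g_s^w(n)$ is the maximum number of edges of an $n$-vertex graph in $\mathcal{G}_s^w$. *)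

(* Defs.v *)
From HB Require Import structures.
From mathcomp Require Import all_boot all_order all_algebra.
From mathcomp Require Import all_classical all_reals all_analysis.

Set Implicit Arguments.
Unset Strict Implicit.
Unset Printing Implicit Defensive.

Import Order.TTheory GRing.Theory Num.Theory.
Import numFieldNormedType.Exports.

Record sgraph (T : finType) := SGraph {
  edges : {set {set T}};
  edgesP : [forall e in edges, #|e| == 2]
}.

HB.instance Definition _ (T : finType) := [isSub for @edges T].
HB.instance Definition _ (T : finType) := [Finite of sgraph T by <:].

(* [inl i] is u_(i+1) and [inr j] is v_(j+1). *)
Definition Lvertex (n : nat) : finType := ('I_(n./2) + 'I_(uphalf n))%type.

Definition Larc (n : nat) (x y : Lvertex n) : bool :=
  match x, y with
  | inl i, inl i' => (i' == i.+1 :> nat)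
  | inr j, inr j' => (j' == j.+1 :> nat)
  | inl i, inr j =>
      [|| (i == 0 :> nat) && (j == 0 :> nat),
          (i == j.+1 :> nat) | (j == i.+1 :> nat)]
  | inr _, inl _ => false
  end.

Definition Ledges (n : nat) : {set {set Lvertex n}} :=
  [set e | [exists x, exists y, Larc x y && (e == [set x; y])]].

Lemma LedgesP (n : nat) : [forall e in Ledges n, #|e| == 2].
Proof.
apply/forall_inP => e; rewrite inE => /existsP[x /existsP[y /andP[xy /eqP->]]].
rewrite cards2; suff -> : x != y by [].
apply: contraTneq xy => ->.
by case: y => i /=; rewrite eq_sym eqn_leq ltnn.
Qed.

Definition L (n : nat) : sgraph (Lvertex n) := SGraph (LedgesP n).

Local Open Scope ring_scope.
Local Open Scope classical_set_scope.

Definition conv_hull (R : realType) (V : lmodType R) (X : set V) : set V :=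
  smallest (@convex_set R V) X.

Definition boundary (T : topologicalType) (A : set T) : set T :=
  closure A `\` interior A.

(* The vertices of a convex polygon are its extreme points. *)
Definition extreme_point (R : realType) (V : lmodType R) (C : set V) (x : V) :=
  C x /\ forall (y z : V) (t : R), C y -> C z -> 0 < t < 1 ->
    x = t *: y + (1 - t) *: z -> y = x /\ z = x.

Definition strictly_convex (R : realType) (X : set 'rV[R]_2) :=
  X `<=` extreme_point (conv_hull X).

Definition weakly_convex (R : realType) (X : set 'rV[R]_2) :=
  X `<=` boundary (conv_hull X).

Definition midpoint (R : realType) (T : finType) (f : T -> 'rV[R]_2)
    (e : {set T}) : 'rV[R]_2 :=
  2^-1 *: \sum_(x in e) f x.

Definition is_drawing (R : realType) (T : finType) (G : sgraph T)
    (f : T -> 'rV[R]_2) :=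
  [/\ injective f,
      {in edges G &, injective (midpoint f)} &
      forall (e : {set T}) (x : T), e \in edges G -> midpoint f e <> f x].

Definition Gsw (R : realType) (T : finType) (G : sgraph T) : Prop :=
  exists f : T -> 'rV[R]_2,
    [/\ is_drawing G f,
        strictly_convex (range f) &
        weakly_convex (midpoint f @` [set` edges G])].

(* Every n-vertex graph is isomorphic to one on 'I_n.  The edgeless graph is
   always in the class, so the default value 0 of \max is never used. *)
Definition gsw (R : realType) (n : nat) : nat :=
  (\max_(G : sgraph 'I_n | `[< Gsw R G >]) #|edges G|)%N.

(* Main.v *)
Require Import Defs.
From mathcomp Require Import all_boot all_order all_algebra.
From mathcomp Require Import all_classical all_reals all_analysis.
From mathcomp Require Import zify ring lra.

(* Call the pair u_(i+1), v_(i+1) row i, so that, besides the single edge inside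
   row 0, the edges of L_n join consecutive rows in all four ways.  Put row i on
   a horizontal line at height h_i, where h_0, h_1, h_2, ... = 1, -1, 3, -3, 5,
   -5, ...; consecutive heights add up to 0 or 2, so every midpoint lies on one
   of the lines y = 0 and y = 1 and all other midpoints lie on one side of that
   line.  The abscissas only have to make the vertices strictly convex and the
   midpoints distinct: the v's go on the parabola x = y^2 and the u's on the
   opposite parabola x = W - y^2 + y, with W large.  Without the linear term y
   the midpoints of u_i v_(i+1) and v_i u_(i+1) would coincide whenever
   h_i + h_(i+1) = 0. *)

Set Implicit Arguments.
Unset Strict Implicit.
Unset Printing Implicit Defensive.

Import Order.TTheory GRing.Theory Num.Theory.
Import numFieldNormedType.Exports.

Local Open Scope ring_scope.
Local Open Scope classical_set_scope.

(** * Linear forms as certificates for extreme points and boundary points *)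

Lemma scalar_conv (R : realType) (V : lmodType R) (l : V -> R) (a : R)
    (u v : V) : scalar l -> l (a *: u + (1 - a) *: v) = a * l u + (1 - a) * l v.
Proof.
move=> ll; have l0 : l 0 = 0 by have := ll 1 0 0; rewrite scale1r addr0; lra.
by rewrite ll -[(1 - a) *: v]addr0 ll l0 addr0.
Qed.

Lemma convex_setP (R : realType) (V : lmodType R) (A : set V) :
  (forall (x y : V) (t : R), A x -> A y -> 0 < t -> t < 1 ->
    A (t *: x + (1 - t) *: y)) -> convex_set A.
Proof.
move=> cA; apply/convex_setW => x y /set_mem Ax /set_mem Ay k k0 k1.
by apply/mem_set; exact: cA.
Qed.

Lemma sub_conv_hull (R : realType) (V : lmodType R) (X : set V) :
  X `<=` conv_hull X.
Proof. exact: sub_gen_smallest. Qed.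

(** The point [p] together with the open half-space [l p < l q] is a convex set containing [X],
    hence the hull; on it [l] attains its minimum only at [p]. *)
Lemma extreme_point_conv_hull (R : realType) (V : lmodType R) (X : set V)
    (l : V -> R) (p : V) : scalar l -> X p ->
  (forall q, X q -> q <> p -> l p < l q) -> extreme_point (conv_hull X) p.
Proof.
move=> ll Xp lp.
have cC : convex_set [set q | q = p \/ l p < l q].
  apply: convex_setP => x y t /= Cx Cy t0 t1.
  case: Cx => [->|lx]; case: Cy => [->|ly];
    first (by left; rewrite -scalerDl addrCA subrr addr0 scale1r);
    by right; rewrite scalar_conv//; nra.
have hC : conv_hull X `<=` [set q | q = p \/ l p < l q].
  apply: smallest_sub => // q Xq.
  by have [->|nq] := pselect (q = p); [left | right; exact: lp].
split; first exact: sub_conv_hull.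
move=> y z t /hC Cy /hC Cz /andP[t0 t1] /(congr1 l); rewrite scalar_conv//.
by case: Cy => [->|ly]; case: Cz => [->|lz] // E; exfalso; nra.
Qed.

(** The hull stays in the half-space [l p <= l q], and an arbitrarily small move from [p] along [v]
    leaves it, so [p] is not interior. *)
Lemma boundary_conv_hull (R : realType) (V : normedModType R) (X : set V)
    (l : V -> R) (p v : V) : scalar l -> l v < 0 -> X p ->
  (forall q, X q -> l p <= l q) -> boundary (conv_hull X) p.
Proof.
move=> ll lv Xp lp; split.
  by apply: subset_closure; exact: sub_conv_hull.
have cC : convex_set [set q | l p <= l q].
  by apply: convex_setP => x y t /= Cx Cy t0 t1; rewrite scalar_conv//; nra.
have hC := smallest_sub cC lp.
move=> pC.
have /(_ _ pC) : (fun t : R => t *: v + p) @ 0 --> p.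
  rewrite -[X in _ --> X]add0r -[X in _ --> X + _](scale0r v).
  by apply: cvgD; [apply: cvgZr_tmp; exact: cvg_id | exact: cvg_cst].
move=> /nbhs_ballP[e /= e0 /(_ (e / 2))].
rewrite -ball_normE /= sub0r normrN gtr0_norm ?divr_gt0// => /(_ _) /hC.
rewrite /= ll => H.
have : l p <= e / 2 * l v + l p by apply: H; lra.
nra.
Qed.

(** * Integer coordinates and their sums over two consecutive rows *)

Definition height (i : nat) : int := if odd i then - i%:Z else i.+1%:Z.

(** The flag [s] is true for the u's. Here W is [4 * (n + 1) ^ 2]: heights are at most [n] in
    absolute value, and separating the two parabolas by tangents takes W above [3 * n ^ 2 + n]. *)
Definition abscissa (n : nat) (s : bool) (i : nat) : int :=
  if s then 4 * n.+1%:Z ^+ 2 - height i ^+ 2 + height i else height i ^+ 2.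

Lemma height_inj : injective height.
Proof. by move=> i j; rewrite /height; case: ifP; case: ifP; lia. Qed.

Lemma height_bound (n i : nat) : (i < n)%N -> (- n%:Z <= height i <= n%:Z)%R.
Proof. by rewrite /height; case: ifP; lia. Qed.

Lemma heightDS (i : nat) : height i + height i.+1 = if odd i then 2 else 0.
Proof. by rewrite /height /=; case: (odd i) => /=; lia. Qed.

(** Equal height sums give [i] and [j] the same parity. Since W dominates, the abscissa sum tells
    how many of the two ends are u's. With none or two, the remainder is quadratic in [i] and
    determines it; with one, it is linear in [i] and its sign tells which end is the u. *)
Lemma edge_sum_inj (n i j : nat) (s t s' t' : bool) : (i < n)%N -> (j < n)%N ->
  height i + height i.+1 = height j + height j.+1 ->
  abscissa n s i + abscissa n t i.+1 = abscissa n s' j + abscissa n t' j.+1 ->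
  [/\ i = j, s = s' & t = t'].
Proof.
move=> li lj; rewrite !heightDS /abscissa /height /=.
have Hi : i%:Z * i%:Z <= n%:Z * n%:Z by nia.
have Hj : j%:Z * j%:Z <= n%:Z * n%:Z by nia.
have sq_inj : i%:Z * i%:Z + i%:Z = j%:Z * j%:Z + j%:Z -> i = j by nia.
(* For two v's or two u's, the part of the sum depending on [i] is plus or minus twice this
   expression, for either parity. *)
have sq_inj2 : i%:Z * i%:Z + 2 * i%:Z = j%:Z * j%:Z + 2 * j%:Z -> i = j by nia.
case: (boolP (odd i)); case: (boolP (odd j)) => oj oi //= _;
case: s; case: t; case: s'; case: t' => E; split => //; lia.
Qed.

(** The edge inside row 0 has height sum 2 and abscissa sum W + 1. Height sum 2 forces [i] odd, and
    then a mixed pair has abscissa sum W + 3i + 4 or W - 3i - 2, while an unmixed one is far from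
    W. *)
Lemma edge_sum_neq0 (n i : nat) (s t : bool) : (i < n)%N ->
  height i + height i.+1 = height 0 + height 0 ->
  abscissa n s i + abscissa n t i.+1 <> abscissa n true 0 + abscissa n false 0.
Proof.
move=> li; rewrite !heightDS /abscissa /height /=.
have Hi : i%:Z * i%:Z <= n%:Z * n%:Z by nia.
case: (boolP (odd i)) => oi; last by lia.
by move=> _; case: s; case: t => /=; lia.
Qed.

(** * Rows, sides and the edges they determine *)

Definition Lrow (n : nat) (x : Lvertex n) : nat :=
  match x with inl i => i | inr j => j end.

Definition Lside (n : nat) (x : Lvertex n) : bool :=
  if x is inl _ then true else false.

Lemma Lvertex_inj (n : nat) (x y : Lvertex n) :
  Lside x = Lside y -> Lrow x = Lrow y -> x = y.
Proof. by case: x y => [i|i] [j|j] //= _ /val_inj ->. Qed.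

Lemma ltn_Lrow (n : nat) (x : Lvertex n) : (Lrow x < n)%N.
Proof. by case: x => i /=; have := ltn_ord i; lia. Qed.

Lemma sum_set2 (T : finType) (V : nmodType) (F : T -> V) (x y : T) :
  x != y -> \sum_(z in [set x; y]%SET) F z = F x + F y.
Proof. by move=> xy; rewrite big_setU1 ?inE//= big_set1. Qed.

(** [Larc] orients every crossing edge from u to v; here a step always goes from row i to row i + 1,
    so that path edges and crossing edges are treated alike. *)
Variant Ledge_spec (n : nat) : {set Lvertex n} -> Prop :=
  | LedgeRung x y of Lrow x = 0%N & Lrow y = 0%N & Lside x & ~~ Lside y :
      Ledge_spec [set x; y]%SET
  | LedgeStep x y of Lrow y = (Lrow x).+1 : Ledge_spec [set x; y]%SET.

Lemma LedgeP (n : nat) (e : {set Lvertex n}) :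
  reflect (Ledge_spec e) (e \in Ledges n).
Proof.
apply: (iffP idP) => [|[x y x0 y0 sx sy|x y xy]].
- rewrite inE => /existsP[x /existsP[y /andP[xy /eqP->]]].
  case: x y xy => [i|i] [j|j] //= /eqP.
  + by move=> ij; exact: LedgeStep.
  + move=> /eqP/or3P[/andP[/eqP i0 /eqP j0]|/eqP ij|/eqP ij].
    * exact: LedgeRung.
    * by rewrite finset.setUC; exact: LedgeStep.
    * exact: LedgeStep.
  + by move=> ij; exact: LedgeStep.
- rewrite inE; apply/existsP; exists x; apply/existsP; exists y.
  rewrite eqxx andbT; move: x y x0 y0 sx sy => [i|//] [//|j] /= -> -> _ _.
  by rewrite eqxx.
- case: x y xy => [i|i] [j|j] /= ij; rewrite inE; apply/existsP;
    [exists (inl i)|exists (inl i)|exists (inl j)|exists (inr i)];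
    apply/existsP;
    [exists (inl j)|exists (inr j)|exists (inr i)|exists (inr j)];
    rewrite /= ij ?eqxx ?orbT//=.
  by rewrite finset.setUC eqxx.
Qed.

Lemma Lstep_sum (n : nat) (V : nmodType) (F : Lvertex n -> V) x y :
  Lrow y = (Lrow x).+1 -> \sum_(z in [set x; y]%SET) F z = F x + F y.
Proof.
by move=> xy; apply: sum_set2; apply: contra_eqN xy => /eqP ->; lia.
Qed.

Lemma Lrung_sum (n : nat) (V : nmodType) (F : Lvertex n -> V) x y :
  Lside x -> ~~ Lside y -> \sum_(z in [set x; y]%SET) F z = F x + F y.
Proof.
by move=> sx sy; apply: sum_set2; apply: contraNneq sy => <-.
Qed.

(** * Coordinate sums over edges *)

Definition Lx (n : nat) (x : Lvertex n) : int := abscissa n (Lside x) (Lrow x).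

Definition Ly (n : nat) (x : Lvertex n) : int := height (Lrow x).

Lemma Lrung_neq_step (n : nat) (x y x' y' : Lvertex n) :
  Lrow x = 0%N -> Lrow y = 0%N -> Lside x -> ~~ Lside y ->
  Lrow y' = (Lrow x').+1 -> Lx x' + Lx y' = Lx x + Lx y ->
  Ly x' + Ly y' <> Ly x + Ly y.
Proof.
move=> x0 y0 sx /negbTE sy xy'; rewrite /Lx /Ly x0 y0 sx sy xy' => EX EY.
exact: edge_sum_neq0 (ltn_Lrow x') EY EX.
Qed.

Lemma Lstep_inj (n : nat) (x y x' y' : Lvertex n) :
  Lrow y = (Lrow x).+1 -> Lrow y' = (Lrow x').+1 ->
  Lx x + Lx y = Lx x' + Lx y' -> Ly x + Ly y = Ly x' + Ly y' ->
  x = x' /\ y = y'.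
Proof.
move=> xy xy'; rewrite /Lx /Ly xy xy' => EX EY.
have [rx sx sy] := edge_sum_inj (ltn_Lrow x) (ltn_Lrow x') EY EX.
by split; apply: Lvertex_inj; rewrite // xy xy' rx.
Qed.

(** This is the distinctness of midpoints, doubled so as to stay within the integers. *)
Lemma Ledges_inj (n : nat) (e f : {set Lvertex n}) :
  e \in Ledges n -> f \in Ledges n ->
  \sum_(z in e) Lx z = \sum_(z in f) Lx z ->
  \sum_(z in e) Ly z = \sum_(z in f) Ly z -> e = f.
Proof.
move=> /LedgeP[x y x0 y0 sx sy|x y xy] /LedgeP[x' y' x0' y0' sx' sy'|x' y' xy'].
- move=> _ _; congr [set _; _]%SET; apply: Lvertex_inj.
  + by rewrite sx sx'.
  + by rewrite x0 x0'.
  + by rewrite (negbTE sy) (negbTE sy').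
  + by rewrite y0 y0'.
- rewrite !(Lrung_sum _ sx sy) !(Lstep_sum _ xy') => /esym EX /esym.
  by move/(Lrung_neq_step x0 y0 sx sy xy' EX).
- rewrite !(Lrung_sum _ sx' sy') !(Lstep_sum _ xy) => EX.
  by move/(Lrung_neq_step x0' y0' sx' sy' xy EX).
- rewrite !(Lstep_sum _ xy') !(Lstep_sum _ xy) => EX EY.
  by have [-> ->] := Lstep_inj xy xy' EX EY.
Qed.

Lemma sum_Ly (n : nat) (e : {set Lvertex n}) : e \in Ledges n ->
  \sum_(z in e) Ly z = 0 \/ \sum_(z in e) Ly z = 2.
Proof.
move=> /LedgeP[x y x0 y0 sx sy|x y xy].
- by rewrite (Lrung_sum _ sx sy) /Ly x0 y0; right.
- by rewrite (Lstep_sum _ xy) /Ly xy heightDS; case: odd; [right | left].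
Qed.

(** * Counting vertices and edges *)

Lemma card_Lvertex (n : nat) : #|Lvertex n| = n.
Proof. by rewrite card_sum !card_ord; lia. Qed.

(** As [uphalf n] exceeds [n./2] by at most one, only the last row can lack its u, and the row
    before that of [x] is complete. *)
Lemma Lbelow_exists (n : nat) (x : Lvertex n) (s : bool) : (0 < Lrow x)%N ->
  exists2 y : Lvertex n, Lrow x = (Lrow y).+1 & Lside y = s.
Proof.
move=> x0.
have ltu : ((Lrow x).-1 < n./2)%N.
  by case: x x0 => i /=; have := ltn_ord i; lia.
have ltv : ((Lrow x).-1 < uphalf n)%N by lia.
by case: s; [exists (inl (Ordinal ltu)) | exists (inr (Ordinal ltv))];
  rewrite //=; lia.
Qed.

(** Each of the [n - 2] vertices outside row 0 is joined to both vertices of the preceding row; with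
    the edge inside row 0 this makes [2 * (n - 2) + 1] edges. *)
Lemma card_Ledges_ge (n : nat) : (2 <= n)%N -> (2 * n - 3 <= #|Ledges n|)%N.
Proof.
move=> hn.
have hu : (0 < n./2)%N by lia.
have hv : (0 < uphalf n)%N by lia.
pose u0 : Lvertex n := inl (Ordinal hu).
pose v0 : Lvertex n := inr (Ordinal hv).
pose A := [set x : Lvertex n | (0 < Lrow x)%N]%SET.
have cA : (n - 2 <= #|A|)%N.
  have := cardsC A; rewrite card_Lvertex.
  suff : (#|~: A| <= 2)%N by lia.
  apply: leq_trans (_ : #|[set u0; v0]%SET| <= 2)%N; last first.
    by rewrite cards2; case: eqP.
  apply/subset_leq_card/fintype.subsetP => x.
  rewrite !inE -leqNgt leqn0 => /eqP x0.
  by case: x x0 => i i0; apply/orP; [left|right]; apply/eqP; apply: Lvertex_inj.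
(* The default [p.1] is returned only for vertices of row 0, which lie outside [A]. *)
pose below (p : Lvertex n * bool) : Lvertex n :=
  odflt p.1 [pick y | (Lrow p.1 == (Lrow y).+1) && (Lside y == p.2)].
have belowP x s : (0 < Lrow x)%N ->
    Lrow x = (Lrow (below (x, s))).+1 /\ Lside (below (x, s)) = s.
  move=> x0; rewrite /below /=; case: pickP => [y /andP[/eqP-> /eqP->] //|].
  by have [y -> <- /(_ y)] := Lbelow_exists s x0; rewrite !eqxx.
pose E (p : Lvertex n * bool) := [set below p; p.1]%SET.
pose AB := finset.setX A [set: bool]%SET.
have Einj : {in AB &, injective E}.
  move=> [x s] [x' s']; rewrite !inE !andbT => Ax Ax' EE.
  have [xy sy] := belowP x s Ax; have [xy' sy'] := belowP x' s' Ax'.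
  (* Equal edges have equal coordinate sums, so the injectivity proved for midpoints also identifies
     the endpoints. *)
  have := congr1 (fun e : {set Lvertex n} => \sum_(z in e) Lx z) EE.
  have := congr1 (fun e : {set Lvertex n} => \sum_(z in e) Ly z) EE.
  rewrite !Lstep_sum// => EY EX.
  have [yy -> ] := Lstep_inj xy xy' EX EY.
  by rewrite -sy -sy' yy.
have r0 : [set u0; v0]%SET \notin E @: AB.
  apply/imsetP => -[[x s]]; rewrite !inE !andbT => Ax EE.
  have [xy _] := belowP x s Ax.
  have := congr1 (fun e : {set Lvertex n} => \sum_(z in e) Lx z) EE.
  have := congr1 (fun e : {set Lvertex n} => \sum_(z in e) Ly z) EE.
  rewrite !(@Lrung_sum _ _ _ u0 v0)// !(Lstep_sum _ xy) => EY EX.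
  exact: (@Lrung_neq_step n u0 v0) xy (esym EX) (esym EY).
have sub : [set u0; v0]%SET |: (E @: AB) \subset Ledges n.
  apply/fintype.subsetP => e /setU1P[->|/imsetP[[x s]]].
    by apply/LedgeP; exact: LedgeRung.
  move=> Ax ->; apply/LedgeP; apply: LedgeStep.
  by move: Ax; rewrite !inE andbT => /(belowP x s)[].
apply: leq_trans (subset_leq_card sub).
rewrite cardsU1 r0 card_in_imset// cardsX cardsT card_bool; lia.
Qed.

(** * The drawing in the plane and its convexity *)

Definition Ldraw (R : realType) (n : nat) (x : Lvertex n) : 'rV[R]_2 :=
  \row_j (if j == 0 then Lx x else Ly x)%:~R.

Lemma Ldraw_inj (R : realType) (n : nat) : injective (@Ldraw R n).
Proof.
move=> x y /rowP E.
have := E 0; have := E 1; rewrite !mxE /= => /intr_inj EY /intr_inj EX.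
have rxy := height_inj EY; apply: Lvertex_inj => //.
move: EX; rewrite /Lx rxy /abscissa.
(* The two vertices of a row of height h would have equal abscissas only if W = 2h^2 - h, which the
   bound on h excludes. *)
have := height_bound (ltn_Lrow y).
by case: (Lside x); case: (Lside y) => //; nia.
Qed.

(* The linear form of [y] whose level line through [x] is tangent to the parabola
   carrying [x]. *)
Definition Lsupport (n : nat) (x y : Lvertex n) : int :=
  if Lside x then (1 - 2 * Ly x) * Ly y - Lx y else Lx y - 2 * Ly x * Ly y.

(** If [y] is on the parabola of [x], the difference is the square of the difference of their
    heights; if it is on the other one, the size of W makes the difference positive. *)
Lemma Lsupport_lt (n : nat) (x y : Lvertex n) :
  y <> x -> Lsupport x x < Lsupport x y.
Proof.
move=> yx; rewrite /Lsupport /Lx /Ly /abscissa.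
have := height_bound (ltn_Lrow x); have := height_bound (ltn_Lrow y).
have [rxy|/eqP rxy] := eqVneq (Lrow x) (Lrow y).
  have : Lside x <> Lside y by move=> s; apply: yx; apply: Lvertex_inj.
  by rewrite rxy; case: (Lside x); case: (Lside y) => //= _; nia.
have {rxy} : height (Lrow x) <> height (Lrow y) by move/height_inj.
by case: (Lside x); case: (Lside y) => //= ; nia.
Qed.

Lemma strictly_convex_Ldraw (R : realType) (n : nat) :
  strictly_convex (range (@Ldraw R n)).
Proof.
move=> _ [x _ <-].
pose a : int := if Lside x then -1 else 1.
pose b : int := if Lside x then 1 - 2 * Ly x else - 2 * Ly x.
pose l (q : 'rV[R]_2) : R := a%:~R * q 0 0 + b%:~R * q 0 1.
have lE y : l (Ldraw R y) = (Lsupport x y)%:~R.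
  rewrite /l !mxE /= -!intrM -intrD /Lsupport /a /b; congr intr.
  by case: (Lside x); ring.
apply: (@extreme_point_conv_hull _ _ _ l) => [k u v|//|_ [y _ <-] yx].
  by rewrite /l !mxE; ring.
by rewrite !lE ltr_int; apply: Lsupport_lt => xy; apply: yx; rewrite xy.
Qed.

Lemma sum_Ldraw (R : realType) (n : nat) (e : {set Lvertex n}) :
  \sum_(x in e) Ldraw R x =
  \row_j (if j == 0 then \sum_(x in e) Lx x else \sum_(x in e) Ly x)%:~R.
Proof.
apply/rowP => j; rewrite summxE mxE.
under eq_bigr do rewrite mxE.
by case: (j == 0); rewrite rmorph_sum.
Qed.

Lemma midpoint_Ldraw_inj (R : realType) (n : nat) :
  {in Ledges n &, injective (midpoint (@Ldraw R n))}.
Proof.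
move=> e f eL fL; rewrite /midpoint !sum_Ldraw => /rowP E.
apply: Ledges_inj => //; [have := E 0 | have := E 1];
  rewrite !mxE /= => /mulfI H; apply/(@intr_inj R)/H;
  by rewrite invr_eq0 pnatr_eq0.
Qed.

Lemma weakly_convex_Ldraw (R : realType) (n : nat) :
  weakly_convex (midpoint (@Ldraw R n) @` [set` Ledges n]).
Proof.
have yE e : e \in Ledges n ->
    midpoint (@Ldraw R n) e 0 1 = 0 \/ midpoint (@Ldraw R n) e 0 1 = 1.
  move=> /sum_Ly; rewrite /midpoint sum_Ldraw !mxE /= => -[|] ->.
  - by left; rewrite mulr0.
  - by right; rewrite mulVf// pnatr_eq0.
move=> _ [e /= eL <-].
(* Any vector with positive ordinate would do: [- up] leaves the strip between the two lines across
   y = 0, and [up] leaves it across y = 1. *)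
pose up : 'rV[R]_2 := \row_j 1.
case: (yE _ eL) => ye.
- apply: (@boundary_conv_hull _ _ _ (fun q : 'rV[R]_2 => q 0 1) _ (- up)) => //.
  + by move=> k u v; rewrite !mxE.
  + by rewrite !mxE; lra.
  + by move=> _ [f /= /yE fy <-]; rewrite ye; case: fy => ->; lra.
- apply: (@boundary_conv_hull _ _ _ (fun q : 'rV[R]_2 => - q 0 1) _ up) => //.
  + by move=> k u v; rewrite !mxE; ring.
  + by rewrite !mxE; lra.
  + by move=> _ [f /= /yE fy <-]; rewrite ye; case: fy => ->; lra.
Qed.

(** A midpoint is interior to a segment between two distinct points of the hull, which an extreme
    point never is. *)
Lemma midpoint_neq_vertex (R : realType) (T : finType) (G : sgraph T)
    (f : T -> 'rV[R]_2) (e : {set T}) (x : T) : injective f ->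
  strictly_convex (range f) -> e \in edges G -> midpoint f e <> f x.
Proof.
move=> finj fconv eG E.
have /cards2P[y [z [yz eyz]]] : #|e| == 2 by apply: (forall_inP (edgesP G)).
have [_ ext] : extreme_point (conv_hull (range f)) (f x).
  by apply: fconv; exists x.
have [] := ext (f y) (f z) 2^-1.
- by apply: sub_conv_hull; exists y.
- by apply: sub_conv_hull; exists z.
- by rewrite invr_gt0 ltr0n invf_lt1 ?ltr0n// ltr1n.
- rewrite -E /midpoint eyz sum_set2// scalerDr.
  by congr (_ + _ *: _); lra.
by move=> /finj yx /finj zx; move: yz; rewrite yx zx eqxx.
Qed.

Lemma Gsw_L (R : realType) (n : nat) : Gsw R (L n).
Proof.
exists (@Ldraw R n); split.
- split; [exact: Ldraw_inj | exact: midpoint_Ldraw_inj|].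
  move=> e x; apply: midpoint_neq_vertex; first exact: Ldraw_inj.
  exact: strictly_convex_Ldraw.
- exact: strictly_convex_Ldraw.
- exact: weakly_convex_Ldraw.
Qed.

(** * Transport along a bijection of vertex sets, and the bound on [gsw] *)

Lemma preim_edgesP (S T : finType) (h : S -> T) (G : sgraph T) :
  injective h ->
  [forall e in [set e : {set S} | h @: e \in edges G]%SET, #|e| == 2].
Proof.
move=> hi; apply/forall_inP => e; rewrite inE => /(forall_inP (edgesP G)).
by rewrite card_imset.
Qed.

(** [gsw] ranges over graphs on ['I_n], whereas [L n] lives on a sum type. Composing the drawing
    with [h] changes neither the set of vertex positions nor the set of midpoints. *)
Lemma Gsw_preim (R : realType) (S T : finType) (h : S -> T) (G : sgraph T) :
  bijective h -> Gsw R G ->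
  exists2 G' : sgraph S, Gsw R G' & #|edges G'| = #|edges G|.
Proof.
move=> [k hk kh] [f [[finj minj mf] fs fw]].
have hi : injective h := can_inj hk.
have khE (e : {set T}) : h @: (k @: e) = e.
  by rewrite -imset_comp (eq_imset _ kh) imset_id.
exists (SGraph (preim_edgesP G hi)).
  have mE e : midpoint (f \o h) e = midpoint f (h @: e).
    by rewrite /midpoint big_imset//= => x y _ _ /hi.
  exists (f \o h); split.
  - split; first exact: inj_comp.
    + move=> e e'; rewrite !inE !mE => eG eG' /(minj _ _ eG eG').
      exact: imset_inj.
    + by move=> e x; rewrite inE mE => eG; exact: mf.
  - suff -> : range (f \o h) = range f by [].
    apply/seteqP; split => [_ [x _ <-]|_ [x _ <-]]; first by exists (h x).
    by exists (k x) => //=; rewrite kh.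
  - set X := (X in weakly_convex X).
    suff -> : X = midpoint f @` [set` edges G] by [].
    apply/seteqP; split => [_ [e /= eG <-]|_ [e /= eG <-]].
      by exists (h @: e); rewrite ?mE//; move: eG; rewrite inE.
    by exists (k @: e); rewrite /= ?inE ?mE khE.
rewrite -(card_imset _ (imset_inj hi)); congr #|pred_of_set _|.
apply/finset.setP => e; apply/imsetP/idP => [[e']|eG].
  by rewrite inE => ? ->.
by exists (k @: e); rewrite ?inE khE.
Qed.

Theorem theorem5 (R : realType) (n : nat) (hn : (2 <= n)%N) :
  Gsw R (L n) /\ (2 * n - 3 <= gsw R n)%N.
Proof.
split; first exact: Gsw_L.
have cn := card_Lvertex n.
have hbij : bijective (fun i : 'I_n => enum_val (cast_ord (esym cn) i)).
  exists (fun x : Lvertex n => cast_ord cn (enum_rank x)) => [i|x].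
    by rewrite enum_valK cast_ordKV.
  by rewrite cast_ordK enum_rankK.
have [G GG cG] := Gsw_preim hbij (Gsw_L R n).
apply: leq_trans (card_Ledges_ge hn) _.
rewrite (_ : #|Ledges n| = #|edges G|)// /gsw.
by apply: leq_bigmax_cond; exact/asboolP.
Qed.
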